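(* Let $\mathbb{F}_q$ be a finite field with $q$ elements. For each $\epsilon>0$ there exist an infinite sequence $\omega=(f_i)_{i\in\mathbb{N}}$ of pairwise distinct polynomials in $\mathbb{F}_q[T]$, indexed so that $\deg f_i\le \deg f_j$ whenever $i<j$, and a positive integer $K$ such that $r_h(\omega)<K$ for all $h\in\mathbb{F}_q[T]$ and $q^{\deg f_i}\ll i^{2+\epsilon}$ (i.e. there is a constant $C>0$ with $q^{\deg f_i}\le C\, i^{2+\epsilon}$ for all $i$).
   Context: We write $f\in\omega$ if $f$ occurs in $\omega$. For $h \in \mathbb{F}_q[T]$ define $r_h(\omega) = |\{(f,g)\in \mathbb{F}_q[T]\times\mathbb{F}_q[T] : f,g\in\omega,\ f+g=h,\ \deg f,\deg g\le \deg h,\ f\neq g\}|$ (ordered pairs). Convention: $\deg 0=-\infty$, $q^{-\infty}=0$. *)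

(* Defs.v *)
From HB Require Import structures.
From mathcomp Require Import all_boot all_order all_algebra qpoly finmap.
From mathcomp Require Import all_classical all_reals all_analysis.

Set Implicit Arguments.
Unset Strict Implicit.
Unset Printing Implicit Defensive.

Import Order.TTheory GRing.Theory Num.Theory.

Local Open Scope classical_set_scope.
Local Open Scope ring_scope.

(* Throughout, [deg f <= deg g] is rendered as [(size f <= size g)%N]: since
   [size f] is [deg f + 1] for [f != 0] and [size 0 = 0], this agrees with the
   comparison of degrees under the convention [deg 0 = -oo]. *)

(* [q ^ deg f], with [q ^ -oo = 0] for [f = 0]. *)
Definition qdeg (F : finFieldType) (f : {poly F}) : nat :=
  if f == 0 then 0%N else (#|F| ^ (size f).-1)%N.

Definition reprs (F : finFieldType) (w : nat -> {poly F}) (h : {poly F}) :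
    set ({poly F} * {poly F}) :=
  [set fg | [/\ range w fg.1, range w fg.2, fg.1 + fg.2 = h,
               (size fg.1 <= size h)%N /\ (size fg.2 <= size h)%N
             & fg.1 <> fg.2]].

(* [fset_set] returns the empty set on infinite sets; this guarantees that
   [r_count] below is a genuine cardinality. *)
Lemma finite_reprs (F : finFieldType) (w : nat -> {poly F}) (h : {poly F}) :
  finite_set (reprs w h).
Proof.
pose v (p : {poly_(size h) F} * {poly_(size h) F}) : {poly F} * {poly F} :=
  (polyn p.1, polyn p.2).
apply: (@sub_finite_set _ _ (range v)); last first.
  by apply: finite_image; exact: finite_finset.
move=> [f g] [_ _ _ [/= hf hg] _].
by exists (@NPoly F (size h) f hf, @NPoly F (size h) g hg).
Qed.

Definition r_count (F : finFieldType) (w : nat -> {poly F}) (h : {poly F}) :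
    nat :=
  #|` fset_set (reprs w h)|%fset.

(* Main.v *)
(* Since only pairs with deg f, deg g <= deg h are counted, one of the summands
   has degree exactly deg h. Choose the f_i greedily, in stages: at stage m all
   new elements have degree d = (2g+1)m + 2, and the stage lasts until there are
   N = q^(gm) elements. With lam = q^m, consider the potential, the sum of
   lam^(r(h)) over the h of degree d, where r(h) counts unordered representations
   among the elements chosen so far; it starts at no more than q^(d+1).
   Averaging over the q^d monic candidates, some new element multiplies the
   potential by at most 1 + lam N / (q^d - N). As 4 lam N^2 <= q^d, the potential
   stays below 2 q^(d+1), and lam^(r(h)) <= 2 q^(d+1) bounds r(h) in terms of g
   alone. An h of degree d has no representation before stage m, and gains none
   that counts after it, so the stages do not interact. Finally
   q^(deg f_i) << i^(2 + 1/g). *)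
Require Import Defs.
From HB Require Import structures.
From mathcomp Require Import all_boot all_order all_algebra.
From mathcomp Require Import all_classical all_reals all_analysis.
From mathcomp Require Import qpoly finmap zify.
Import Order.TTheory GRing.Theory Num.Theory.
Local Open Scope classical_set_scope.
Local Open Scope ring_scope.

(** * Representations by a finite list *)

(** Each unordered pair is counted at the member listed first. Only the tail is tested, so [x + x]
    is not counted in a list without repetition. *)
Fixpoint pair_count (V : zmodType) (h : V) (s : seq V) : nat :=
  if s is x :: s' then ((h - x \in s')%R + pair_count V h s')%N else 0%N.
Arguments pair_count {V}.

Fixpoint pairs_summing (V : zmodType) (h : V) (s : seq V) : seq (V * V) :=
  if s is x :: s' then
    if h - x \in s' then (x, h - x) :: (h - x, x) :: pairs_summing V h s'
    else pairs_summing V h s'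
  else [::].
Arguments pairs_summing {V}.

Lemma size_pairs_summing (V : zmodType) (h : V) (s : seq V) :
  size (pairs_summing h s) = (pair_count h s).*2.
Proof. by elim: s => //= x s IHs; case: ifP => _ /=; rewrite IHs. Qed.

Lemma mem_pairs_summing (V : zmodType) (f g : V) (s : seq V) :
  f \in s -> g \in s -> f <> g -> (f, g) \in pairs_summing (f + g) s.
Proof.
elim: s => //= x s IHs; rewrite !inE => /predU1P[->|fs] /predU1P[->|gs] fg //.
- by rewrite [x + g]addrC addrK gs inE eqxx.
- by rewrite addrK fs !inE eqxx orbT.
- by case: ifP => _; rewrite ?inE IHs ?orbT.
Qed.

Lemma pair_count_size_lt (F : finFieldType) (s : seq {poly F}) (h : {poly F}) :
  {in s, forall x : {poly F}, (size x < size h)%N} -> pair_count h s = 0%N.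
Proof.
elim: s => //= x s IHs lt_s.
rewrite IHs; last by move=> y ys; apply: lt_s; rewrite inE ys orbT.
case hx_s: (h - x \in s) => //; have := lt_s _ (mem_head x s).
have := lt_s (h - x); rewrite inE hx_s orbT => /(_ isT) hx x_h.
have := size_polyD (h - x) x; rewrite subrK leqNgt gtn_max.
by rewrite hx x_h.
Qed.

(** * Greedy choice by averaging a potential *)

Section Greedy.
Variables (V : zmodType) (I J : finType) (c : I -> V) (e : J -> V).
Variables (P : pred J) (lam : nat).
Hypothesis c_inj : injective c.

Definition potential (s : seq V) : nat :=
  (\sum_(j | P j) lam ^ pair_count (e j) s)%N.

(** The terms that adding [x] multiplies by [lam]: their targets gain a representation. *)
Definition increment (s : seq V) (x : V) : nat :=
  (\sum_(j | P j) (e j - x \in s)%R * lam ^ pair_count (e j) s)%N.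

Lemma potential_cons (s : seq V) (x : V) :
  (potential (x :: s) <= potential s + lam * increment s x)%N.
Proof.
rewrite /potential /increment big_distrr -big_split /=.
apply: leq_sum => j _; case: (_ \in s) => /=.
  by rewrite mul1n add1n expnS leq_addl.
by rewrite !add0n mul0n muln0 addn0.
Qed.

Lemma card_candidates_in (s : seq V) (u : V -> V) :
  injective u -> (#|[pred i | u (c i) \in s]| <= size s)%N.
Proof.
move=> u_inj; rewrite cardE -(size_map (u \o c)).
apply: uniq_leq_size => [|y /mapP[i]].
  by rewrite map_inj_uniq ?enum_uniq //; exact: inj_comp.
by rewrite mem_enum => ci_s ->.
Qed.

(** After exchanging the sums, each target [e j] meets at most [size s] candidates, since
    [e j - c i] determines [c i]. *)
Lemma sum_increment_le (s : seq V) :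
  (\sum_i increment s (c i) <= size s * potential s)%N.
Proof.
rewrite exchange_big /= /potential big_distrr /=.
apply: leq_sum => j _; rewrite -big_distrl leq_mul2r /=.
apply/orP; right; rewrite -big_mkcond sum1_card.
apply: (card_candidates_in s (fun x => e j - x)).
by move=> x y /addrI /oppr_inj.
Qed.

(* The element minimizing the increment does at least as well as the average
   given by [sum_increment_le]. *)
Lemma greedy_step (s : seq V) : (size s < #|I|)%N ->
  exists2 i, c i \notin s &
    (potential (c i :: s) * (#|I| - size s) <=
     potential s * (#|I| - size s) + lam * (size s * potential s))%N.
Proof.
move=> s_small; pose A := [pred i | c i \notin s].
have card_A : (#|I| - size s <= #|A|)%N.
  rewrite leq_subLR -(cardC [pred i | c i \in s]) leq_add2r.
  exact: (card_candidates_in s id).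
have A_gt0 : (0 < #|A|)%N by apply: leq_trans card_A; rewrite subn_gt0.
have /card_gt0P[i0 Ai0] := A_gt0.
have [i Ai i_min] := arg_minnP (fun i => increment s (c i)) Ai0.
exists i => //.
have avg : (increment s (c i) * (#|I| - size s) <= size s * potential s)%N.
  apply: leq_trans (sum_increment_le s).
  apply: (@leq_trans (\sum_(k in A) increment s (c i))%N).
    by rewrite sum_nat_const mulnC leq_mul2r card_A orbT.
  rewrite [leqRHS](bigID (mem A)) /=; apply: leq_trans (leq_addr _ _).
  by apply: leq_sum => k Ak; exact: i_min.
apply: leq_trans (leq_mul (potential_cons s (c i)) (leqnn _)) _.
by rewrite mulnDl leq_add2l -mulnA leq_mul2l avg orbT.
Qed.

End Greedy.
Arguments potential {V J}.

(** * Stages of constant degree and their invariant *)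

Section Stages.
Variables (F : finFieldType) (g : nat).
Hypothesis g_gt0 : (0 < g)%N.
Let q := #|F|.
Let q_gt1 : (1 < q)%N. Proof. exact: card_finNzRing_gt1. Qed.
Let q_gt0 : (0 < q)%N. Proof. exact: ltnW. Qed.

(** The least m with n + 1 < q^(gm). It is at least 1, and stage m ends at index q^(gm) - 2. *)
Definition stage (n : nat) : nat := (trunc_log (q ^ g) n.+1).+1.
Definition stage_deg (m : nat) : nat := ((2 * g + 1) * m + 2)%N.

Let qg_gt1 : (1 < q ^ g)%N. Proof. by rewrite -(expn0 q) ltn_exp2l. Qed.

Lemma stage_lt (n : nat) : (n.+1 < q ^ (g * stage n))%N.
Proof. by rewrite expnM; exact: trunc_log_ltn. Qed.

Lemma stage_ge (n : nat) : (q ^ (g * (stage n).-1) <= n.+1)%N.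
Proof. by rewrite expnM; exact: trunc_logP. Qed.

Lemma leq_stage (m n : nat) : (m <= n)%N -> (stage m <= stage n)%N.
Proof. by move=> mn; rewrite ltnS leq_trunc_log. Qed.

Lemma ltn_stage_deg (m n : nat) : (stage_deg m < stage_deg n)%N = (m < n)%N.
Proof. by rewrite /stage_deg ltn_add2r ltn_pmul2l // addn1. Qed.

Lemma leq_stage_deg (m n : nat) : (stage_deg m <= stage_deg n)%N = (m <= n)%N.
Proof. by rewrite leqNgt ltn_stage_deg -leqNgt. Qed.

Definition stage_potential (m : nat) (s : seq {poly F}) : nat :=
  potential (fun h : {poly_(stage_deg m).+1 F} => val h)
    (fun h => size (val h) == (stage_deg m).+1) (q ^ m) s.

(** [m] is the stage of the next element. With D its degree, N = q^(gm) and n = [size s], the bound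
    is q^(D+1) (1 + n/N), cleared of denominators. *)
Definition controlled (s : seq {poly F}) : Prop :=
  let m := stage (size s) in
  {in s, forall x : {poly F}, size x <= (stage_deg m).+1}%N /\
  (stage_potential m s * q ^ (g * m) <=
   q ^ (stage_deg m).+1 * (q ^ (g * m) + size s))%N.

(** The third clause is separate because [controlled (x :: s)] speaks of the next stage once [x]
    closes stage [m]. *)
Definition good_extension (s : seq {poly F}) (x : {poly F}) : Prop :=
  let m := stage (size s) in
  [/\ x \notin s, size x = (stage_deg m).+1,
      (stage_potential m (x :: s) <= 2 * q ^ (stage_deg m).+1)%N
    & controlled (x :: s)].

Lemma stage_potential_fresh (m : nat) (s : seq {poly F}) :
  {in s, forall x : {poly F}, size x < (stage_deg m).+1}%N ->
  (stage_potential m s <= q ^ (stage_deg m).+1)%N.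
Proof.
move=> small; rewrite -card_npoly -sum1_card /stage_potential /potential.
rewrite big_mkcond /=; apply: leq_sum => h _; case: ifP => // /eqP hD.
by rewrite pair_count_size_lt // => x /small; rewrite hD.
Qed.

Lemma controlled_nil : controlled [::].
Proof.
split=> //; rewrite addn0 leq_mul2r; apply/orP; right.
exact: stage_potential_fresh.
Qed.

(** The offset 2 in [stage_deg] supplies the factor 4 <= q^2. *)
Lemma potential_room (m : nat) :
  (4 * (q ^ m * q ^ (g * m) * q ^ (g * m)) <= q ^ stage_deg m)%N.
Proof.
rewrite mulnC -!expnD.
have -> : (m + g * m + g * m = (2 * g + 1) * m)%N by lia.
by rewrite expnD leq_mul2l -[4%N]/(2 ^ 2)%N leq_exp2r // q_gt1 orbT.
Qed.

(** Each step adds at most q^(D+1) / N to the potential, so fewer than N steps at most double the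
    initial bound q^(D+1). *)
Lemma good_extension_exists (s : seq {poly F}) :
  controlled s -> exists x, good_extension s x.
Proof.
rewrite /controlled /good_extension.
set n := size s; set m := stage n => -[s_le Phi_le].
pose D := stage_deg m; pose N := (q ^ (g * m))%N.
have nN : (n.+1 < N)%N := stage_lt n.
have room := potential_room m; rewrite -/D -/N in room Phi_le.
pose c (p : {poly_D F}) : {poly F} := 'X^D + val p.
have c_inj : injective c by move=> p1 p2 /addrI /val_inj.
have card_c : #|{poly_D F}| = (q ^ D)%N by rewrite card_npoly.
have lt_n : (n < #|{poly_D F}|)%N by rewrite card_c; nia.
have [p] := @greedy_step _ _ _ c
  (fun h : {poly_D.+1 F} => val h) (fun h => size (val h) == D.+1)
  (q ^ m)%N c_inj s lt_n.
rewrite -![potential _ _ _ _]/(stage_potential m _) card_c -/n.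
set x := c p; move=> x_s; set Phi := stage_potential m s in Phi_le *.
set Phi' := stage_potential m (x :: s).
move=> step.
have size_x : size x = D.+1.
  by rewrite size_polyDl ?size_polyXn // ltnS size_npoly.
have Phi2 : (Phi <= 2 * q ^ D.+1)%N.
  have : (Phi * N <= 2 * q ^ D.+1 * N)%N.
    by apply: (leq_trans Phi_le); rewrite [leqRHS]mulnAC mulnC leq_mul2r; lia.
  by rewrite leq_pmul2r //; lia.
have Phi'_le : (Phi' * N <= q ^ D.+1 * (N + n.+1))%N.
  (* As Phi <= 2 q^(D+1), this makes the gain q^m n Phi / (q^D - n) at most q^(D+1) / N. *)
  have room' : (2 * (q ^ m * n * N) <= q ^ D - n)%N by nia.
  have : (Phi' * N * (q ^ D - n) <= q ^ D.+1 * (N + n.+1) * (q ^ D - n))%N.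
    set M := (q ^ D - n)%N in step room' *.
    apply: (@leq_trans ((Phi * M + q ^ m * (n * Phi)) * N)%N).
      by rewrite mulnAC leq_mul2r step orbT.
    have : (q ^ m * (n * Phi) * N <= q ^ D.+1 * M)%N.
      apply: (@leq_trans (q ^ m * (n * (2 * q ^ D.+1)) * N)%N).
        by rewrite leq_mul2r !leq_mul2l Phi2 !orbT.
      apply: (@leq_trans (q ^ D.+1 * (2 * (q ^ m * n * N)))%N).
        by rewrite eq_leq //; lia.
      by rewrite leq_mul2l room' orbT.
    have : (Phi * N * M <= q ^ D.+1 * (N + n) * M)%N.
      by rewrite leq_mul2r Phi_le orbT.
    by rewrite mulnDl; lia.
  by rewrite leq_pmul2r //; rewrite card_c in lt_n; lia.
have Phi'2 : (Phi' <= 2 * q ^ D.+1)%N.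
  have : (Phi' * N <= 2 * q ^ D.+1 * N)%N.
    by apply: (leq_trans Phi'_le); rewrite [leqRHS]mulnAC mulnC leq_mul2r; lia.
  by rewrite leq_pmul2r //; lia.
exists x; split => //.
have x_le : {in x :: s, forall y : {poly F}, size y <= D.+1}%N.
  by move=> y; rewrite inE => /predU1P[->|/s_le //]; rewrite size_x.
rewrite /controlled /= -/n.
(* Either the stage continues, or all of [x :: s] lies below the next degree and the potential
   starts afresh. *)
have := leq_stage _ _ (leqnSn n); rewrite -/m leq_eqVlt => /predU1P[<- //|lt_m].
have small : {in x :: s,
    forall y : {poly F}, size y < (stage_deg (stage n.+1)).+1}%N.
  by move=> y /x_le y_le; apply: leq_ltn_trans y_le _; rewrite ltnS ltn_stage_deg.
split=> [y /small /ltnW //|].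
by apply: leq_mul; [exact: stage_potential_fresh | rewrite leq_addr].
Qed.

(** One term is at most the whole potential, so with r the count, q^(m r) <= q^(D+2), where D + 2 =
    (2g + 1) m + 4 <= (2g + 5) m. *)
Lemma pair_count_le_stage (m : nat) (s : seq {poly F}) (h : {poly F}) :
  (0 < m)%N -> size h = (stage_deg m).+1 ->
  (stage_potential m s <= 2 * q ^ (stage_deg m).+1)%N ->
  (pair_count h s <= 2 * g + 5)%N.
Proof.
move=> m_gt0 size_h Phi_le.
have h_le : (size h <= (stage_deg m).+1)%N by rewrite size_h.
have : ((q ^ m) ^ pair_count h s <= q ^ (stage_deg m).+2)%N.
  apply: leq_trans (_ : 2 * q ^ (stage_deg m).+1 <= _)%N; last first.
    by rewrite [leqRHS]expnS leq_mul2r q_gt1 orbT.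
  apply: leq_trans Phi_le; rewrite /stage_potential /potential.
  by rewrite (bigD1 (NPoly h_le)) /= ?size_h // leq_addr.
rewrite -expnM leq_exp2l // /stage_deg => le.
by rewrite -(leq_pmul2l m_gt0); lia.
Qed.

(** * The infinite sequence and its growth *)

Lemma greedy_sequence :
  exists w : nat -> {poly F},
    [/\ injective w, forall n, size (w n) = (stage_deg (stage n)).+1
      & forall h, (r_count w h < 4 * g + 11)%N].
Proof.
have ext s : exists x, controlled s -> good_extension s x.
  by have [/good_extension_exists[x xP]|] := pselect (controlled s);
    [exists x | exists 0].
have [nx nxP] := boolp.choice ext.
pose st n := iter n (fun s => nx s :: s) [::].
pose w n := nx (st n).
have size_st n : size (st n) = n by elim: n => //= n ->.
have ctrl n : controlled (st n).
  elim: n => [|n IHn]; first exact: controlled_nil.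
  by have [] := nxP _ IHn.
have good n : good_extension (st n) (w n) by exact: nxP.
have mem_st i n : (i < n)%N -> w i \in st n.
  elim: n => // n IHn; rewrite ltnS leq_eqVlt inE => /predU1P[->|/IHn ->].
    by rewrite eqxx.
  by rewrite orbT.
have size_w n : size (w n) = (stage_deg (stage n)).+1.
  by have [_ -> _ _] := good n; rewrite size_st.
exists w; split => //.
  have w_neq i j : (i < j)%N -> w i <> w j.
    by move=> /mem_st wi eq_w; have [/negP] := good j; rewrite -eq_w.
  by move=> i j eq_w; case: (ltngtP i j) => // /w_neq; rewrite eq_w.
move=> h.
have [[k size_h]|no_k] := pselect (exists k, size h = (stage_deg (stage k)).+1);
  last first.
  rewrite /r_count (_ : reprs w h = set0) ?fset_set0 ?cardfs0; first by lia.
  rewrite -subset0 => -[f f'] [/= [i _ <-] [j _ <-] sum_h [hi hj] _].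
  (* One summand has exactly the degree of [h], which is then a stage degree. *)
  have := size_polyD (w i) (w j); rewrite sum_h leq_max => /orP[h_le|h_le].
    by apply: no_k; exists i; rewrite -size_w; apply/eqP; rewrite eqn_leq h_le.
  by apply: no_k; exists j; rewrite -size_w; apply/eqP; rewrite eqn_leq h_le.
set m := stage k in size_h.
(* [n] is the last index of stage [m]. *)
pose n := (q ^ (g * m)).-2.
have n2 : (n.+2 = q ^ (g * m))%N.
  by rewrite /n; have := stage_lt k; rewrite -/m; case: (q ^ _)%N => [|[]].
(* Every element that can enter a counted representation of [h] is chosen by the end of stage
   [m]. *)
have le_n i : (size (w i) <= size h)%N -> (i <= n)%N.
  rewrite size_w size_h ltnS leq_stage_deg => stage_i.
  rewrite -ltnS -ltnS n2; apply: leq_trans (stage_lt i) _.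
  by rewrite leq_exp2l // leq_mul2l stage_i orbT.
have stage_n : stage n = m.
  apply/eqP; rewrite eqn_leq; apply/andP; split; last first.
    by apply: leq_stage; rewrite -ltnS -ltnS n2; exact: stage_lt.
  rewrite -(ltn_exp2l _ _ qg_gt1); apply: leq_ltn_trans (trunc_logP _ _) _ => //.
  by rewrite -expnM -n2.
pose t := st n.+1.
have Phi_le : (stage_potential m (t) <= 2 * q ^ (stage_deg m).+1)%N.
  by have [_ _ + _] := good n; rewrite size_st stage_n.
have mem_t i : (size (w i) <= size h)%N -> w i \in t.
  by move=> /le_n i_n; apply: mem_st; rewrite ltnS.
clearbody t; have cnt := pair_count_le_stage m (t) h isT size_h Phi_le.
have sub : reprs w h `<=` [set` [fset z in pairs_summing h (t)]%fset].
  move=> [f f'] [/= [i _ <-] [j _ <-] sum_h [/mem_t wi /mem_t wj] neq].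
  by rewrite inE -sum_h; exact: mem_pairs_summing.
rewrite /r_count; move: sub; rewrite fset_set_sub ?set_fsetK; last 2 first.
- exact: finite_reprs.
- exact: finite_fset.
move=> /fsubset_leq_card /leq_ltn_trans; apply.
(* Ordered pairs double the bound 2g + 5, hence the strict bound 4g + 11. *)
rewrite card_fseq (leq_ltn_trans (size_undup _)) // size_pairs_summing.
by lia.
Qed.

(** With X = q^(m-1), m the stage of [i], the left side is q^(2g+3) X^(2g) X, and X^g <= i + 1 gives
    the exponent 2 + 1/g. *)
Lemma qdeg_stage_le (R : realType) (eps : R) (f : {poly F}) (i : nat) :
  g%:R^-1 <= eps -> size f = (stage_deg (stage i)).+1 ->
  (qdeg f)%:R <= (q ^ (2 * g + 3))%:R * (i.+1%:R `^ (2 + eps)).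
Proof.
move=> g_eps size_f; rewrite /qdeg -size_poly_eq0 size_f /=.
pose X := (q ^ (stage i).-1)%N.
have -> : (#|F| ^ stage_deg (stage i) = q ^ (2 * g + 3) * ((X ^ g) ^ 2 * X))%N.
  rewrite /X /stage_deg -/q -!expnM -!expnD; congr (_ ^ _)%N.
  by rewrite -[stage i]/((stage i).-1.+1) /=; lia.
have Xi : ((X ^ g)%:R : R) <= i.+1%:R.
  by rewrite ler_nat /X -expnM mulnC stage_ge.
rewrite natrM ler_wpM2l // powRD ?pnatr_eq0 ?implybT //.
rewrite powR_mulrn // natrM [(_ ^ 2)%:R]natrX ler_pM //.
  by rewrite lerXn2r ?nnegrE.
apply: (@le_trans _ _ ((i.+1%:R : R) `^ g%:R^-1)); last first.
  by rewrite ler_powR // ler1n.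
have -> : (X%:R : R) = (X ^ g)%:R `^ g%:R^-1.
  by rewrite [(X ^ g)%:R]natrX -powR_mulrn // -powRrM mulfV ?powRr1 // pnatr_eq0 -lt0n.
by apply: ge0_ler_powR; rewrite ?nnegrE ?invr_ge0.
Qed.

End Stages.

(* The sequence f_1, f_2, f_3, ... is [w 0, w 1, w 2, ...]. *)
Theorem theorem1p2 (F : finFieldType) (R : realType) (eps : R)
    (eps_gt0 : 0 < eps) :
  exists (w : nat -> {poly F}) (K : nat),
    [/\ injective w,
        forall i j : nat, (i < j)%N -> (size (w i) <= size (w j))%N,
        (0 < K)%N,
        forall h : {poly F}, (r_count w h < K)%N
      & exists2 C : R, 0 < C &
          forall i : nat, (qdeg (w i))%:R <= C * (i.+1%:R `^ (2 + eps))].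
Proof.
pose g := (Num.truncn eps^-1).+1.
have g_eps : g%:R^-1 <= eps.
  by rewrite invf_ple ?posrE ?ltr0n // ltW // truncnS_gt.
have [w [w_inj size_w r_lt]] := greedy_sequence F g isT.
exists w, (4 * g + 11)%N; split => //.
  by move=> i j /ltnW ij; rewrite !size_w ltnS leq_stage_deg leq_stage.
exists (#|F| ^ (2 * g + 3))%:R.
  by rewrite ltr0n expn_gt0 (ltnW (card_finNzRing_gt1 F)).
by move=> i; apply: qdeg_stage_le.
Qed.
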